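(* Let $\alpha>0$, let $\rho$ be a Poisson point process on $[0,1]\times(0,\infty)$ with intensity $\alpha v^{-(\alpha+1)}\,du\,dv$, and let $L_\alpha$ be the number of linearity intervals of its least concave majorant $\mathfrak{C}_\rho$. If $\alpha\in(0,1)$, then $L_\alpha<\infty$ a.s. If $\alpha\ge1$, then $L_\alpha=\infty$ a.s.; moreover, in this case, a.s. any neighborhood of $0$ (as well as any neighborhood of $1$) contains infinitely many linearity intervals of $\mathfrak{C}_\rho$, and $\lim_{k\to-\infty}R_k=-\infty$ and $\lim_{k\to+\infty}R_k=+\infty$ a.s., where $-R_k$ are the slopes of $\mathfrak{C}_\rho$ on its successive linearity intervals, numbered from left to right.
   Context: Write $\rho=\sum_{k=1}^\infty\delta(U_k,V_k)$. The least concave majorant of $\rho$ is $\mathfrak{C}_\rho(t)=\inf_ff(t)$, $t\in[0,1]$, where the infimum is over all concave functions $f:[0,1]\to[0,\infty)$ with $f(U_k)\ge V_k$ for all $k\in\mathbb{N}$. Almost surely $\mathfrak{C}_\rho$ is piecewise linear with at most countably many linearity intervals (maximal intervals on which it is affine), denoted from left to right by $[X_k,X_{k+1}]$ with $k$ ranging over a finite or infinite discrete interval of $\mathbb{Z}$ (over all of $\mathbb{Z}$ when $\alpha\ge1$), and $\mathfrak{C}_\rho(t)=S_k-R_kt$ for $t\in[X_k,X_{k+1}]$. *)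

(* Defs.v *)
From HB Require Import structures.
From mathcomp Require Import all_boot all_order all_algebra.
From mathcomp Require Import all_classical all_reals all_analysis.
From mathcomp Require Import measurable_realfun.

Set Implicit Arguments.
Unset Strict Implicit.
Unset Printing Implicit Defensive.

Import Order.TTheory GRing.Theory Num.Theory.
Import numFieldNormedType.Exports.

Local Open Scope classical_set_scope.
Local Open Scope ring_scope.

Definition mutually_independent d (Omega : measurableType d) (R : realType)
    (P : probability Omega R) (n : nat) (X : 'I_n -> Omega -> \bar R) : Prop :=
  forall A : 'I_n -> set (\bar R), (forall i, measurable (A i)) ->
    P [set w | forall i, A i (X i w)] =
    (\prod_(i < n) P [set w | A i (X i w)])%E.

(* The Poisson law with mean m in [0, +oo]; for m = +oo it is the point mass at
   +oo. The library's [poisson_prob] has a dummy [nat] argument (here 0).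
   Beware that [poisson_pmf 0 n] is 1 for every n, whereas [poisson_prob 0 _] is
   the point mass at 0, as it should be. *)
Definition has_poisson_law d (Omega : measurableType d) (R : realType)
    (P : probability Omega R) (N : Omega -> \bar R) (m : \bar R) : Prop :=
  if m == +oo%E then P [set w | N w = +oo%E] = 1%E
  else forall n : nat,
    P [set w | N w = n%:R%:E] = poisson_prob (fine m) 0%N [set n].

(* A random measure on T is a kernel from Omega to T. *)
Definition poisson_point_process d d' (Omega : measurableType d)
    (T : measurableType d') (R : realType) (P : probability Omega R)
    (mu : set T -> \bar R) (rho : R.-ker Omega ~> T) : Prop :=
  (forall B : set T, measurable B ->
     has_poisson_law P (fun w => rho w B) (mu B)) /\
  (forall (n : nat) (B : 'I_n -> set T), (forall i, measurable (B i)) ->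
     trivIset [set: 'I_n] B ->
     mutually_independent P (fun i w => rho w (B i))).

Section ConcaveMajorant.
Variable R : realType.
Implicit Types (alpha : R) (C : R -> R).

Local Notation plane := (measurableTypeR R * measurableTypeR R)%type.

Definition strip : set plane := [set z | 0 <= z.1 <= 1 /\ 0 < z.2].

(* alpha v^-(alpha+1) du dv on [0,1] x (0,oo), seen as a measure on the plane *)
Definition stable_intensity alpha (B : set plane) : \bar R :=
  (\int[lebesgue_measure \x lebesgue_measure]_(z in B `&` strip)
     (alpha * z.2 `^ (- (alpha + 1)))%:E)%E.

(* Functions on [0,1] are represented by functions on R, of which only the
   values on [0,1] matter. *)
Definition concave_majorants (U V : nat -> R) : set (R -> R) :=
  [set f | [/\ @convex_function R R^o `[0, 1] (fun t => - f t),
               forall t, 0 <= t <= 1 -> 0 <= f t &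
               forall k, V k <= f (U k)]].

(* The real-valued [inf] of the empty set is 0; this occurs only when no concave
   majorant exists. *)
Definition least_concave_majorant (U V : nat -> R) (t : R) : R :=
  inf [set f t | f in concave_majorants U V].

Definition affine_on C (a b : R) : Prop :=
  exists s r : R, forall t, a <= t <= b -> C t = s - r * t.

(* The pairs (a, b) such that [a, b], with a < b, is a maximal subinterval of
   [0,1] on which C is affine. *)
Definition linearity_intervals C : set (R * R) :=
  [set I | [/\ 0 <= I.1, I.1 < I.2, I.2 <= 1, affine_on C I.1 I.2 &
    forall a b, 0 <= a <= I.1 -> I.2 <= b <= 1 -> affine_on C a b ->
      (a, b) = I]].

Definition number_of_linearity_intervals C : \bar R :=
  counting (linearity_intervals C).

(* The linearity intervals, listed from left to right, are the [x k, x (k + 1)]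
   for k ranging over Z, and C t = s k - r k * t on the k-th one. *)
Definition numbering C (x s r : int -> R) : Prop :=
  [/\ forall k, x k < x (k + 1),
      linearity_intervals C = [set (x k, x (k + 1)) | k in [set: int]] &
      forall k t, x k <= t <= x (k + 1) -> C t = s k - r k * t].

End ConcaveMajorant.

(* Main.v *)
Require Import Defs.
From HB Require Import structures.
From mathcomp Require Import all_boot all_order all_algebra.
From mathcomp Require Import all_classical all_reals all_analysis.
From mathcomp Require Import measurable_realfun.
From mathcomp Require Import ring lra zify.

Set Implicit Arguments.
Unset Strict Implicit.
Unset Printing Implicit Defensive.

Import Order.TTheory GRing.Theory Num.Theory.
Import numFieldNormedType.Exports.

Local Open Scope classical_set_scope.
Local Open Scope ring_scope.

(** The proof separates what is true of every locally finite configuration of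
    points from the three facts about Poisson processes that it needs.

    Let C be the least concave majorant of points (u_k, v_k) in (0,1) x (0,oo)
    such that, for each e > 0, finitely many of them are higher than e. If a
    chord of C lies above all the points over its base, then C coincides with it
    ([least_majorant_chord]), since otherwise cutting C by the chord would give
    a smaller majorant. Near an interior point t, only points over t itself can
    come close to the graph of C, so C is affine on one-sided neighbourhoods of
    t ([least_majorant_affine_right], [least_majorant_affine_left]), and on a
    two-sided one unless a point touches the graph at t
    ([least_majorant_affine_untouched]). So the breakpoints in (0,1) do not
    accumulate inside (0,1), and each of them carries a point of the
    configuration. Moreover C tends to 0 at 0 and at 1 ([least_majorant_small0],
    [least_majorant_small1]).

    What remains is the behaviour at the ends. The intensity of the points above
    the line of slope c issued from an end of [0,1] is governed by the integral
    of v^(-alpha) near 0: slices of these wedges have length v / c, and the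
    density is alpha v^(-alpha-1) ([stable_intensity_wedge_lty],
    [stable_intensity_wedge_y]).

    If alpha < 1 it is finite, so that almost surely finitely many points lie
    above any tent vanishing at 0 and 1. But C lies above such a tent, hence is
    touched by finitely many points and has finitely many linearity intervals
    ([least_majorant_finite_intervals]).

    If alpha >= 1 it is infinite, so that almost surely there are points above
    every line through (0,0) or (1,0), however steep. Then C is affine on no
    neighbourhood of an end ([not_affine_at1]). Every linearity interval thus
    has a successor and a predecessor, and the resulting chains exhaust (0,1),
    for their limits cannot be interior points ([right_chain_cvg]). This yields
    the numbering by the integers and infinitely many intervals near both ends;
    the slopes diverge because C is steeper, on average, than any line between a
    suitable point and the end ([right_chain_slopes]). *)

(** * Concave functions and intervals of affinity *)

Section Deterministic.
Context {R : realType}.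
Implicit Types (C f : R -> R) (t x y z p q : R).

(** The three-point form of concavity, cleared of denominators: no convex weight
    has to be computed, and the inequality is linear in the values of [f]. *)
Definition concave01 f := forall x y z, 0 <= x -> x <= y -> y <= z -> z <= 1 ->
  (z - y) * f x + (y - x) * f z <= (z - x) * f y.

Lemma conv_realE (a b : convex_lmodType R^o) (t : {i01 R}) :
  conv t a b = t%:num * a + (1 - t%:num) * b :> R.
Proof. by []. Qed.

Lemma concave01P f :
  @convex_function R R^o `[0, 1] (fun t => - f t) <-> concave01 f.
Proof.
split=> [cf x y z x0 xy yz z1|cf t x y].
  have [xz|xz] := eqVneq x z.
    have -> : y = x by apply/eqP; rewrite eq_le xy xz yz.
    by rewrite -xz !subrr !mul0r addr0.
  have xz' : 0 < z - x by rewrite subr_gt0 lt_neqAle xz (le_trans xy).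
  have s01 : 0 <= (z - y) / (z - x) <= 1.
    by rewrite divr_ge0 ?ler_pdivrMr ?mul1r ?subr_ge0 ?(le_trans xy)//=; lra.
  pose s : {i01 R} := Itv01 (proj1 (andP s01)) (proj2 (andP s01)).
  have xI : x \in (`[0, 1]%classic : set R) by rewrite inE/= in_itv/=; lra.
  have zI : z \in (`[0, 1]%classic : set R) by rewrite inE/= in_itv/=; lra.
  have := cf s x z xI zI.
  rewrite !convRE/= [X in - f X](_ : _ = y); last first.
    by rewrite conv_realE /unstable.onem/=; field; lra.
  rewrite !mulrN -opprD lerN2 /unstable.onem => H.
  rewrite -(@ler_pM2r _ (z - x)^-1) ?invr_gt0//.
  have zx : z - x != 0 by rewrite gt_eqF.
  have -> : (z - x) * f y / (z - x) = f y by field.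
  apply: le_trans H; rewrite le_eqVlt; apply/orP; left; apply/eqP; by field.
rewrite !inE/= !in_itv/= => xI yI;
  rewrite conv_realE convRE !mulrN -opprD lerN2.
have s0 : 0 <= t%:num :> R by exact: ge0.
have s1 : t%:num <= 1 :> R by exact: le1.
move: (t%:num) s0 s1 => s s0 s1.
rewrite /unstable.onem; wlog : x y s s0 s1 xI yI / x <= y.
  move=> H; case: (leP x y) => xy; first exact: H.
  have := H y x (1 - s); rewrite subKr.
  rewrite ![(1 - s) * _ + _]addrC; apply; lra.
rewrite le_eqVlt => /predU1P[<-|xy].
  by rewrite -!mulrDl addrCA subrr addr0 !mul1r.
have H := cf x (s * x + (1 - s) * y) y.
rewrite -(@ler_pM2l _ (y - x)) ?subr_gt0//.
apply: le_trans (H _ _ _ _); [|lra|nra|nra|lra].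
rewrite le_eqVlt; apply/orP; left; apply/eqP; ring.
Qed.

Lemma concave01_affine (a b : R) : concave01 (fun t => a + b * t).
Proof.
by move=> x y z *; rewrite le_eqVlt; apply/orP; left; apply/eqP; ring.
Qed.

Lemma concave01_min f g :
  concave01 f -> concave01 g -> concave01 (fun t => Num.min (f t) (g t)).
Proof.
move=> cf cg x y z x0 xy yz z1.
have xz : x <= z by exact: le_trans yz.
have := cf x y z x0 xy yz z1; have := cg x y z x0 xy yz z1.
have mf a : Num.min (f a) (g a) <= f a by rewrite ge_min lexx.
have mg a : Num.min (f a) (g a) <= g a by rewrite ge_min lexx orbT.
have W h : (z - y) * h x + (y - x) * h z <= (z - x) * h y ->
    (forall a, Num.min (f a) (g a) <= h a) ->
  (z - y) * Num.min (f x) (g x) + (y - x) * Num.min (f z) (g z) <=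
    (z - x) * h y.
  move=> hh mh; apply: le_trans hh; apply: lerD; apply: ler_wpM2l => //; lra.
move=> /W/(_ mg) Hg /W/(_ mf) Hf.
by rewrite {3}/Num.min; case: ifP => _.
Qed.

Lemma finite_set_ub (A : set nat) (g : nat -> R) : finite_set A ->
  exists2 K, 0 < K & forall k, A k -> g k <= K.
Proof.
move=> /finite_seqP[s ->]; elim: s => [|a s [K K0 IH]].
  by exists 1.
exists (Num.max K (g a)); first by rewrite lt_max K0.
move=> k /=; rewrite inE => /predU1P[->|ks]; rewrite le_max ?lexx ?orbT//.
by rewrite IH.
Qed.

Lemma finite_set_pos_lb (A : set nat) (g : nat -> R) : finite_set A ->
  (forall k, A k -> 0 < g k) -> exists2 e, 0 < e & forall k, A k -> e <= g k.
Proof.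
move=> fA g0; have [K K0 HK] := finite_set_ub (fun k => (g k)^-1) fA.
exists K^-1; rewrite ?invr_gt0// => k Ak.
by rewrite -[leRHS]invrK lef_pV2 ?posrE ?invr_gt0 ?HK ?g0.
Qed.

Lemma inv_bound_le (e : R) : 0 < e -> (Num.bound e^-1).+1%:R^-1 <= e.
Proof.
move=> e0; rewrite -[leRHS]invrK lef_pV2 ?posrE ?invr_gt0//.
apply: le_trans (ltW (archi_boundP _)) _; first by rewrite invr_ge0 ltW.
by rewrite ler_nat.
Qed.

Lemma affine_on_sub C a b a' b' :
  affine_on C a b -> a <= a' -> b' <= b -> affine_on C a' b'.
Proof.
move=> [s [r Cab]] aa bb; exists s, r => t /andP[at_ tb]; apply: Cab.
by rewrite (le_trans aa)// (le_trans tb).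
Qed.

Lemma line_unique (s r s' r' a b : R) : a < b ->
  s - r * a = s' - r' * a -> s - r * b = s' - r' * b -> s = s' /\ r = r'.
Proof.
move=> ab Ea Eb; have rr : r = r'.
  have /eqP : (r - r') * (b - a) = 0 by lra.
  by rewrite mulf_eq0 subr_eq0 => /orP[/eqP|/eqP]//; lra.
by split=> //; move: Ea; rewrite rr; lra.
Qed.

Lemma affine_on_glue C a b c d : affine_on C a b -> affine_on C c d ->
  a <= c -> c < b -> b <= d -> affine_on C a d.
Proof.
move=> [s [r Cab]] [s' [r' Ccd]] ac cb bd.
have Ec : s - r * c = s' - r' * c by rewrite -Cab ?Ccd//; lra.
have Eb : s - r * b = s' - r' * b by rewrite -Cab ?Ccd//; lra.
have [ss rr] := line_unique cb Ec Eb.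
exists s, r => t tad; case: (leP t b) => tb; first by apply: Cab; lra.
by rewrite ss rr; apply: Ccd; lra.
Qed.

(** Two overlapping intervals of affinity merge into one, so a maximal one
    swallows every interval of affinity that meets its interior. *)
Lemma linearity_interval_max C I c d : linearity_intervals C I ->
  affine_on C c d -> 0 <= c -> d <= 1 -> c < I.2 -> I.1 < d ->
  I.1 <= c /\ d <= I.2.
Proof.
case: I => a b [/= a0 ab b1 fab maxab] fcd c0 d1 cb ad.
case: (leP a c) => ac; case: (leP d b) => db; split => //; exfalso.
- have fad := affine_on_glue fab fcd ac cb (ltW db).
  have [] : (a, d) = (a, b) by apply: maxab => //=; lra.
  lra.
- have fcb := affine_on_glue fcd fab (ltW ac) ad db.
  have [] : (c, b) = (a, b) by apply: maxab => //=; lra.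
  lra.
- have [] : (c, d) = (a, b) by apply: maxab => //=; lra.
  lra.
- have [] : (c, d) = (a, b) by apply: maxab => //=; lra.
  lra.
Qed.

Lemma linearity_interval_eq C I J : linearity_intervals C I ->
  linearity_intervals C J -> I.1 < J.2 -> J.1 < I.2 -> I = J.
Proof.
move=> iI iJ IJ JI.
have [I0 _ I1 fI _] := iI; have [J0 _ J1 fJ _] := iJ.
have [l1 r1] := linearity_interval_max iI fJ J0 J1 JI IJ.
have [l2 r2] := linearity_interval_max iJ fI I0 I1 IJ JI.
rewrite [I]surjective_pairing [J]surjective_pairing.
by congr pair; apply/eqP; rewrite eq_le ?l1 ?l2 ?r1 ?r2.
Qed.

(** * The least concave majorant of a locally finite configuration *)

Section Majorant.
Variables u v : nat -> R.
Hypothesis u01 : forall k, 0 < u k < 1.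
Hypothesis v_gt0 : forall k, 0 < v k.
Hypothesis v_fin : forall e, 0 < e -> finite_set [set k | e <= v k].

Local Notation C := (least_concave_majorant u v).

(** [concave_majorants] with the three-point form of concavity. *)
Definition majorant f := [/\ concave01 f, forall t, 0 <= t <= 1 -> 0 <= f t &
  forall k, v k <= f (u k)].

Lemma least_majorant_le f t : majorant f -> 0 <= t <= 1 -> C t <= f t.
Proof.
move=> [cf f0 vf] t01; apply: ge_inf => /=.
  by exists 0 => _ [g [_ g0 _] <-]; exact: g0.
by exists f => //; split => //; apply/concave01P.
Qed.

(** Only finitely many points have height at least [e], so a large multiple of
    an affine function that is positive on (0,1), lifted by [e], lies above all
    of them. With [e] small this shows that the least majorant tends to 0 at
    both ends of [0,1]. *)
Lemma affine_majorant (a b e : R) : 0 < e ->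
  (forall t, 0 < t < 1 -> 0 < a + b * t) ->
  (forall t, 0 <= t <= 1 -> 0 <= a + b * t) ->
  exists2 K, 0 < K & majorant (fun t => e + K * (a + b * t)).
Proof.
move=> e0 h0 h0'.
have [K K0 HK] := finite_set_ub (fun k => v k / (a + b * u k)) (v_fin e0).
exists K => //; split.
- move=> x y z *; rewrite le_eqVlt; apply/orP; left; apply/eqP; ring.
- by move=> t /h0' H; rewrite addr_ge0 ?mulr_ge0// ltW.
- move=> k; have h := h0 _ (u01 k); case: (leP e (v k)) => [/HK|vk].
    by rewrite ler_pdivrMr// => H; rewrite ler_wpDl// ltW.
  by rewrite ler_wpDr ?mulr_ge0// ltW.
Qed.

Lemma least_majorant_majorant : majorant C.
Proof.
have [K K0 HK] : exists2 K, 0 < K & majorant (fun t => 1 + K * (1 + 0 * t)).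
  by apply: affine_majorant => // t _; rewrite mul0r addr0.
have ne t : [set f t | f in concave_majorants u v] !=set0.
  exists (1 + K * (1 + 0 * t)); exists (fun t => 1 + K * (1 + 0 * t)) => //.
  by case: HK => ? ? ?; split=> //; apply/concave01P.
split.
- move=> x y z x0 xy yz z1; have xz : x <= z by exact: le_trans yz.
  have [xz'|xz'] := eqVneq x z.
    have -> : y = x by apply/eqP; rewrite eq_le xy xz' yz.
    by rewrite -xz' !subrr !mul0r addr0.
  have zx : 0 < z - x by rewrite subr_gt0 lt_neqAle xz' xz.
  rewrite -ler_pdivrMl//; apply: lb_le_inf => // _ [f [cf f0 vf] <-].
  rewrite ler_pdivrMl//.
  have mf : majorant f by split=> //; apply/concave01P.
  apply: le_trans ((concave01P f).1 cf x y z x0 xy yz z1).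
  by apply: lerD; apply: ler_wpM2l; rewrite ?subr_ge0 ?least_majorant_le//; lra.
- by move=> t t01; apply: lb_le_inf => // _ [f [_ f0 _] <-]; exact: f0.
- by move=> k; apply: lb_le_inf => // _ [f [_ _ vf] <-]; exact: vf.
Qed.

Let cC : concave01 C := let: And3 a _ _ := least_majorant_majorant in a.
Let C_ge0 t : 0 <= t <= 1 -> 0 <= C t.
Proof. by case: least_majorant_majorant => _ + _; exact. Qed.
Let vC k : v k <= C (u k).
Proof. by case: least_majorant_majorant. Qed.

(** A concave nonnegative function above a single point lies above the tent with
    apex at that point, which lies above a multiple of the distance to the
    boundary. *)
Lemma least_majorant_tent t : 0 <= t <= 1 -> v 0%N * Num.min t (1 - t) <= C t.
Proof.
move=> t01; have uu := u01 0%N; have vv := v_gt0 0%N.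
have Cu := vC 0%N; have Ct := C_ge0 t01; have [C0 C1] : 0 <= C 0 /\ 0 <= C 1.
  by split; apply: C_ge0; lra.
set m := Num.min t (1 - t).
have mt : m <= t by rewrite ge_min lexx.
have mt' : m <= 1 - t by rewrite ge_min lexx orbT.
case: (leP t (u 0%N)) => tu.
  have H : (u 0%N - t) * C 0 + (t - 0) * C (u 0%N) <= (u 0%N - 0) * C t.
    by apply: cC; lra.
  have H1 : t * v 0%N <= t * C (u 0%N) by apply: ler_wpM2l => //; lra.
  have H2 : 0 <= (u 0%N - t) * C 0 by rewrite mulr_ge0//; lra.
  have H3 : v 0%N * m <= v 0%N * t by apply: ler_wpM2l => //; exact: ltW.
  have H4 : u 0%N * C t <= 1 * C t by apply: ler_wpM2r => //; lra.
  lra.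
have H : (1 - t) * C (u 0%N) + (t - u 0%N) * C 1 <= (1 - u 0%N) * C t.
  by apply: cC; lra.
have H1 : (1 - t) * v 0%N <= (1 - t) * C (u 0%N) by apply: ler_wpM2l => //; lra.
have H2 : 0 <= (t - u 0%N) * C 1 by rewrite mulr_ge0//; lra.
have H3 : v 0%N * m <= v 0%N * (1 - t) by apply: ler_wpM2l => //; exact: ltW.
have H4 : (1 - u 0%N) * C t <= 1 * C t by apply: ler_wpM2r => //; lra.
lra.
Qed.

Lemma least_majorant_gt0 t : 0 < t < 1 -> 0 < C t.
Proof.
move=> t01; apply: lt_le_trans (least_majorant_tent _); last lra.
by rewrite mulr_gt0// lt_min; lra.
Qed.

(** Replacing the least majorant [C] by its chord between [p] and [q] amounts to
    taking the minimum of [C] and an affine function, because the chord is below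
    [C] inside [p, q] and above [C] outside. The result is concave, and it is
    still a majorant if the chord is above all the points; by minimality [C] is
    then its own chord. *)
Lemma least_majorant_chord p q : 0 <= p -> p < q -> q <= 1 ->
  (forall k, p <= u k <= q ->
     (q - p) * v k <= (q - u k) * C p + (u k - p) * C q) ->
  affine_on C p q.
Proof.
move=> p0 pq q1 below.
have qp0 : 0 < q - p by lra.
pose b := (C q - C p) / (q - p); pose a := C p - b * p.
have lE t : (q - p) * (a + b * t) = (q - t) * C p + (t - p) * C q.
  by rewrite /a /b; field; lra.
have out t : 0 <= t <= 1 -> ~~ (p <= t <= q) -> C t <= a + b * t.
  move=> t01; rewrite negb_and -!ltNge => tpq; rewrite -(ler_pM2l qp0) lE.
  case/orP: tpq => [tp|qt].
    have := @cC t p q _ (ltW tp) (ltW pq) q1; lra.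
  have := @cC p q t p0 (ltW pq) (ltW qt) _; lra.
have ml : majorant (fun t => Num.min (C t) (a + b * t)).
  split; first exact/concave01_min/concave01_affine/cC.
  - move=> t t01; rewrite le_min C_ge0//=; case/boolP: (p <= t <= q) => tpq.
      rewrite -(ler_pM2l qp0) lE mulr0.
      by rewrite addr_ge0// mulr_ge0 ?C_ge0//; lra.
    by apply: le_trans (out _ t01 tpq); exact: C_ge0.
  - move=> k; rewrite le_min vC/=; case/boolP: (p <= u k <= q) => kpq.
      by rewrite -(ler_pM2l qp0) lE; exact: below.
    by apply: le_trans (vC k) (out _ _ kpq); have := u01 k; lra.
exists a, (- b) => t tpq; rewrite mulNr opprK; apply/eqP; rewrite eq_le.
apply/andP; split.
  apply: le_trans (least_majorant_le ml _) _; first lra.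
  by rewrite ge_min lexx orbT.
by rewrite -(ler_pM2l qp0) lE cC//; lra.
Qed.

(** The case of [least_majorant_chord] used below: the chord lies above any
    level [m] below both of its ends. Points above [p] or [q] themselves are
    harmless, being below [C] there. *)
Lemma least_majorant_level (p q m : R) : 0 <= p -> p < q -> q <= 1 ->
  m <= C p -> m <= C q ->
  (forall k, p < u k < q -> v k <= m) -> affine_on C p q.
Proof.
move=> p0 pq q1 mp mq below; apply: least_majorant_chord => // k /andP[].
rewrite le_eqVlt => /predU1P[pE _|pu].
  by rewrite -pE subrr mul0r addr0; apply: ler_wpM2l; [lra|rewrite pE].
rewrite le_eqVlt => /predU1P[qE|uq].
  by rewrite qE subrr mul0r add0r; apply: ler_wpM2l; [lra|rewrite -qE].
have := below k; rewrite pu uq => /(_ isT) vm.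
have : (q - p) * v k <= (q - p) * m by apply: ler_wpM2l => //; lra.
have : (q - u k) * m <= (q - u k) * C p by apply: ler_wpM2l => //; lra.
have : (u k - p) * m <= (u k - p) * C q by apply: ler_wpM2l => //; lra.
lra.
Qed.

(** Above a level [m] there are finitely many points, so near [t] only those
    exactly over [t] can exceed [m]; and [C] itself stays above [m] near [t]
    since concavity and nonnegativity bound it below by the tent with apex on
    the graph at [t]. *)
Lemma least_majorant_near (t m : R) : 0 < t < 1 -> 0 < m < C t ->
  exists2 e, 0 < e & [/\ 0 <= t - e, t + e <= 1,
    forall s, t - e <= s <= t + e -> m <= C s &
    forall k, t - e <= u k <= t + e -> u k != t -> v k <= m].
Proof.
move=> t01 /andP[m0 mC]; have C0 : 0 < C t by apply: lt_trans mC.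
have [d d0 Hd] : exists2 d, 0 < d & [/\ d <= t, d <= 1 - t,
    d * C t <= t * (C t - m) & d * C t <= (1 - t) * (C t - m)].
  (* The radius on which the two sides of the tent stay above m. *)
  pose d := Num.min t (1 - t) * (C t - m) / C t.
  have tau0 : 0 < Num.min t (1 - t) by rewrite lt_min; lra.
  have tau1 : Num.min t (1 - t) <= t by rewrite ge_min lexx.
  have tau2 : Num.min t (1 - t) <= 1 - t by rewrite ge_min lexx orbT.
  have dC : d * C t = Num.min t (1 - t) * (C t - m) by rewrite /d; field; lra.
  have dtau : d <= Num.min t (1 - t).
    by rewrite -(ler_pM2r C0) dC ler_wpM2l; lra.
  exists d; first by rewrite /d !mulr_gt0 ?invr_gt0// subr_gt0.
  by split; [exact: le_trans tau1|exact: le_trans tau2| |];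
    rewrite dC ler_wpM2r//; lra.
case: Hd => dt dt1 d1 d2.
have [g g0 Hg] : exists2 g, 0 < g &
    forall k, m <= v k /\ u k != t -> g <= `|u k - t|.
  apply: (finite_set_pos_lb (A := [set k | m <= v k /\ u k != t])).
    by apply: sub_finite_set (v_fin m0) => k [].
  by move=> k [_ ut]; rewrite normr_gt0 subr_eq0.
pose e := Num.min d (g / 2).
have ed : e <= d by rewrite ge_min lexx.
have eg : e <= g / 2 by rewrite ge_min lexx orbT.
exists e; first by rewrite lt_min d0/=; lra.
split; [lra|lra|move=> s se|move=> k uk ut].
  have eC : e * C t <= d * C t by rewrite ler_pM2r.
  have C_0 : 0 <= C 0 by apply: C_ge0; lra.
  have C_1 : 0 <= C 1 by apply: C_ge0; lra.
  case: (leP s t) => st.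
    have H : (t - s) * C 0 + (s - 0) * C t <= (t - 0) * C s by apply: cC; lra.
    have H0 : 0 <= (t - s) * C 0 by rewrite mulr_ge0//; lra.
    have H1 : (t - s) * C t <= e * C t by rewrite ler_pM2r//; lra.
    have t0 : 0 < t by lra.
    rewrite -(ler_pM2l t0); lra.
  have H : (1 - s) * C t + (s - t) * C 1 <= (1 - t) * C s by apply: cC; lra.
  have H0 : 0 <= (s - t) * C 1 by rewrite mulr_ge0//; lra.
  have H1 : (s - t) * C t <= e * C t by rewrite ler_pM2r//; lra.
  have t0 : 0 < 1 - t by lra.
  rewrite -(ler_pM2l t0); lra.
rewrite leNgt; apply/negP => /ltW mv.
have := Hg k (conj mv ut); move: uk; rewrite -ler_distl; lra.
Qed.

Lemma least_majorant_affine_right t : 0 < t < 1 ->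
  exists q, t < q <= 1 /\ affine_on C t q.
Proof.
move=> t01; have C0 := least_majorant_gt0 t01.
have [e e0 [te te1 Cm vm]] : exists2 e, 0 < e & _ :=
  @least_majorant_near t (C t / 2) t01 ltac:(lra).
exists (t + e); split; first lra.
apply: (@least_majorant_level t (t + e) (C t / 2)); [lra|lra|lra| | |];
  [by apply: Cm; lra..|].
by move=> k uk; apply: vm; [lra|rewrite gt_eqF//; lra].
Qed.

Lemma least_majorant_affine_left t : 0 < t < 1 ->
  exists p, 0 <= p < t /\ affine_on C p t.
Proof.
move=> t01; have C0 := least_majorant_gt0 t01.
have [e e0 [te te1 Cm vm]] : exists2 e, 0 < e & _ :=
  @least_majorant_near t (C t / 2) t01 ltac:(lra).
exists (t - e); split; first lra.
apply: (@least_majorant_level (t - e) t (C t / 2)); [lra|lra|lra| | |];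
  [by apply: Cm; lra..|].
by move=> k uk; apply: vm; [lra|rewrite lt_eqF//; lra].
Qed.

(** If no point touches the graph over [t], then all points near [t] are below a
    common level lower than [C t], and [C] is affine across [t]: a breakpoint in
    (0,1) must carry a point of the configuration. *)
Lemma least_majorant_affine_untouched t : 0 < t < 1 ->
  (forall k, u k = t -> v k < C t) ->
  exists p q, [/\ 0 <= p, p < t, t < q, q <= 1 & affine_on C p q].
Proof.
move=> t01 vC'; have C0 := least_majorant_gt0 t01.
have [g g0 Hg] : exists2 g, 0 < g &
    forall k, C t / 2 <= v k /\ u k = t -> g <= C t - v k.
  apply: (finite_set_pos_lb (A := [set k | C t / 2 <= v k /\ u k = t])).
    have C2 : 0 < C t / 2 by lra.
    by apply: sub_finite_set (v_fin C2) => k [].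
  by move=> k [_ ut]; rewrite subr_gt0 vC'.
(* The second argument dominates the points over t, the first one makes m
   positive. *)
pose m := Num.max (C t / 2) (C t - g).
have m1 : C t / 2 <= m by rewrite le_max lexx.
have m2 : C t - g <= m by rewrite le_max lexx orbT.
have mC : m < C t by rewrite gt_max; lra.
have [e e0 [te te1 Cm vm]] : exists2 e, 0 < e & _ :=
  @least_majorant_near t m t01 ltac:(lra).
exists (t - e), (t + e); split; [lra|lra|lra|lra|].
apply: (@least_majorant_level _ _ m); [lra|lra|lra| | |];
  [by apply: Cm; lra..|].
move=> k uk; have [ut|ut] := eqVneq (u k) t; last by apply: vm => //; lra.
case: (leP (C t / 2) (v k)) => vk; last lra.
have := Hg k (conj vk ut); lra.
Qed.

Lemma least_majorant_small0 e : 0 < e ->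
  exists2 K, 0 < K & forall t, 0 <= t <= 1 -> C t <= e + K * t.
Proof.
move=> e0; have [||K K0 HK] := @affine_majorant 0 1 e e0; [move=> *; lra..|].
by exists K => // t t01; have := least_majorant_le HK t01; rewrite add0r mul1r.
Qed.

Lemma least_majorant_small1 e : 0 < e ->
  exists2 K, 0 < K & forall t, 0 <= t <= 1 -> C t <= e + K * (1 - t).
Proof.
move=> e0; have [||K K0 HK] := @affine_majorant 1 (- 1) e e0;
  [move=> *; lra..|].
by exists K => // t t01; have := least_majorant_le HK t01; rewrite mulN1r.
Qed.

(** By hypothesis finitely many points lie above a multiple of the distance to
    the boundary. As [C] itself lies above such a tent, finitely many points
    touch its graph, and every linearity interval starts at 0 or below one of
    them. *)
Lemma least_majorant_finite_intervals :
  (forall c, 0 < c ->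
     finite_set [set k | c * Num.min (u k) (1 - u k) <= v k]) ->
  finite_set (linearity_intervals C).
Proof.
move=> fin; pose T := [set u k | k in [set k | C (u k) <= v k]].
have fT : finite_set T.
  apply: finite_image; apply: sub_finite_set (fin _ (v_gt0 0%N)) => k /= Ck.
  by apply: le_trans Ck; apply: least_majorant_tent; have := u01 k; lra.
have inj : {in linearity_intervals C &, injective fst}.
  move=> I J; rewrite !inE => iI iJ IJ.
  have [_ I12 _ _ _] := iI; have [_ J12 _ _ _] := iJ.
  by apply: (linearity_interval_eq iI iJ); rewrite ?IJ// -IJ.
have : finite_set [set I.1 | I in linearity_intervals C].
  apply: (@sub_finite_set _ _ (0%R |` T)).
    move=> _ [[a b] I <-] /=; have [/= a0 ab b1 fab maxab] := I.
    have [->|aN0] := eqVneq a 0; first by left.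
    right; apply: contrapT => nT.
    have a01 : 0 < a < 1 by rewrite lt_neqAle eq_sym aN0 a0/=; lra.
    have [k uk|p [q [p0 pa aq q1 fpq]]] := least_majorant_affine_untouched a01.
      by rewrite ltNge -uk; apply/negP => Cv; apply: nT; exists k.
    have [/= ap _] :=
      linearity_interval_max I fpq p0 q1 (lt_trans pa ab) aq.
    lra.
  by rewrite finite_setU; split.
by rewrite (eq_finite_set (inj_card_eq inj)).
Qed.

End Majorant.

End Deterministic.

(** * Concave functions with infinite slopes at both ends *)

Section SteepEnds.
Context {R : realType}.
Implicit Types (C : R -> R) (I J : R * R).

(** All that is used about the least majorant when the slopes are infinite at
    both ends. These properties are exchanged in pairs by the reflection of
    [0,1], so that each fact below is proved at one end only and transported to
    the other by [steep_ends_refl]. *)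
Record steep_ends C : Prop := SteepEnds {
  se_concave : concave01 C;
  se_right : forall t, 0 < t < 1 -> exists q, t < q <= 1 /\ affine_on C t q;
  se_left : forall t, 0 < t < 1 -> exists p, 0 <= p < t /\ affine_on C p t;
  se_small0 : forall e, 0 < e ->
    exists2 K, 0 < K & forall t, 0 <= t <= 1 -> C t <= e + K * t;
  se_small1 : forall e, 0 < e ->
    exists2 K, 0 < K & forall t, 0 <= t <= 1 -> C t <= e + K * (1 - t);
  se_steep0 : forall M, exists2 t, 0 < t < 1 & M * t < C t;
  se_steep1 : forall M, exists2 t, 0 < t < 1 & M * (1 - t) < C t }.

Lemma affine_on_refl C (a b : R) :
  affine_on C a b -> affine_on (fun t => C (1 - t)) (1 - b) (1 - a).
Proof.
move=> [s [r Cab]]; exists (s - r), (- r) => t tab.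
by rewrite Cab; [ring|lra].
Qed.

Lemma linearity_interval_refl C I : linearity_intervals C I ->
  linearity_intervals (fun t => C (1 - t)) (1 - I.2, 1 - I.1).
Proof.
case: I => a b [/= a0 ab b1 fab maxab]; split => /=; [lra|lra|lra| |].
  exact: affine_on_refl.
move=> c d ca db /affine_on_refl.
under [X in affine_on X]eq_fun do rewrite subKr.
move=> fdc; have [] : (1 - d, 1 - c) = (a, b) by apply: maxab => //; lra.
by move=> <- <-; rewrite !subKr.
Qed.

Lemma steep_ends_refl C : steep_ends C -> steep_ends (fun t => C (1 - t)).
Proof.
case=> cC rC lC small0 small1 steep0 steep1; split.
- move=> x y z x0 xy yz z1.
  have : (1 - x - (1 - y)) * C (1 - z) + (1 - y - (1 - z)) * C (1 - x) <=
    (1 - x - (1 - z)) * C (1 - y) by apply: cC; lra.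
  lra.
- move=> t t01; have [|p [p0 fp]] := lC (1 - t); first lra.
  exists (1 - p); split; first lra.
  by have := affine_on_refl fp; rewrite subKr.
- move=> t t01; have [|p [p0 fp]] := rC (1 - t); first lra.
  exists (1 - p); split; first lra.
  by have := affine_on_refl fp; rewrite subKr.
- move=> e /small1[K K0 HK]; exists K => // t t01.
  by have := HK (1 - t); rewrite subKr; apply; lra.
- by move=> e /small0[K K0 HK]; exists K => // t t01; apply: HK; lra.
- move=> M; have [t t01 Ht] := steep1 M.
  by exists (1 - t); [lra|rewrite subKr].
- move=> M; have [t t01 Ht] := steep0 M.
  by exists (1 - t); [lra|rewrite !subKr].
Qed.

(** If [C] were affine near 1 then, as it tends to 0 there, it would be at most
    a multiple of 1 - x near 1, and hence, being bounded, everywhere: this is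
    excluded by [se_steep1]. *)
Lemma not_affine_at1 C (t s r : R) : steep_ends C -> 0 <= t < 1 ->
  ~ (forall x, t <= x < 1 -> C x = s - r * x).
Proof.
move=> hC t01 Cl; pose A := s - r.
have lE x : t <= x < 1 -> C x = A + r * (1 - x).
  by move=> /Cl ->; rewrite /A; ring.
have A0 : A <= 0.
  rewrite leNgt; apply/negP => A0.
  have [K K0 HK] := se_small1 hC (divr_gt0 A0 (ltr0n R 2)).
  have B0 : 0 < K + `|r| + 1 by have := normr_ge0 r; lra.
  pose d := Num.min (1 - t) (A / 2 / (K + `|r| + 1)).
  have d0 : 0 < d by rewrite lt_min !divr_gt0//; lra.
  have dt : d <= 1 - t by rewrite ge_min lexx.
  have dA : d * (K + `|r| + 1) <= A / 2.
    by rewrite -ler_pdivlMr// ge_min lexx orbT.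
  have := HK (1 - d); rewrite lE; last lra.
  rewrite subKr => /(_ _) H.
  have : A + r * d <= A / 2 + K * d by apply: H; lra.
  have := ler_norm (- r); rewrite normrN => rr.
  have : 0 <= (r + `|r|) * d by rewrite mulr_ge0//; lra.
  lra.
have [K K0 HK] := se_small1 hC ltr01.
(* The slope K + 1 / (1 - t) forces u to be beyond t: before t one has
   1 <= (1 - u) / (1 - t). *)
have [u u01 Hu] := se_steep1 hC (Num.max r (K + (1 - t)^-1)).
have m1 : r <= Num.max r (K + (1 - t)^-1) by rewrite le_max lexx.
have m2 : K + (1 - t)^-1 <= Num.max r (K + (1 - t)^-1).
  by rewrite le_max lexx orbT.
have u1 : 0 <= 1 - u by lra.
have {}m1 := ler_wpM2r u1 m1; have {}m2 := ler_wpM2r u1 m2.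
case: (leP t u) => tu; first by have := lE u; lra.
have := HK u.
have : 1 <= (1 - t)^-1 * (1 - u) by rewrite ler_pdivlMl; lra.
lra.
Qed.

Lemma linearity_interval_in C I : steep_ends C -> linearity_intervals C I ->
  0 < I.1 /\ I.2 < 1.
Proof.
suff H C' J : steep_ends C' -> linearity_intervals C' J -> J.2 < 1.
  move=> hC iI; split; last exact: H iI.
  have := H _ _ (steep_ends_refl hC) (linearity_interval_refl iI) => /=; lra.
move=> hC [J0 J12 J1 [s [r fJ]] _]; rewrite lt_neqAle J1 andbT; apply/eqP => J2.
apply: (@not_affine_at1 C' J.1 s r hC) => [|x x1]; first lra.
by apply: fJ; lra.
Qed.

(** The supremum of the [q] such that [C] is affine on [t, q] is attained,
    because [C] is affine on some interval ending at this supremum, and it is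
    not 1 by [not_affine_at1]. *)
Lemma affine_extent_right C t : steep_ends C -> 0 < t < 1 ->
  exists b, [/\ t < b, b < 1, affine_on C t b &
    forall d, b < d -> d <= 1 -> ~ affine_on C t d].
Proof.
move=> hC t01; have [q0 [tq0 [s [r fq0]]]] := se_right hC t01.
pose E := [set q | t < q <= 1 /\ affine_on C t q].
have Eq0 : E q0 by split=> //; exists s, r.
have ubE : ubound E 1 by move=> q [/andP[]].
have supE : has_sup E by split; [exists q0|exists 1].
have Eb q : E q -> q <= sup E by move=> Eq; apply: ub_le_sup Eq; exists 1.
have b1 : sup E <= 1 by apply: ge_sup => //; exists q0.
have tb : t < sup E by apply: lt_le_trans (Eb _ Eq0); case/andP: tq0.
have below x : x < sup E -> exists2 q, E q & x < q.
  by move=> xs; have [q Eq xq] := sup_gt supE.1 xs; exists q.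
have {b1}b1 : sup E < 1.
  rewrite lt_neqAle b1 andbT; apply/eqP => sE.
  apply: (@not_affine_at1 C t s r hC); first lra.
  move=> x /andP[tx]; rewrite -sE => /below[q [tq [s' [r' fq]]] xq].
  have Et : s - r * t = s' - r' * t by rewrite -fq ?fq0//; lra.
  have [m [tm mq mq0]] : exists m, [/\ t < m, m <= q & m <= q0].
    exists (Num.min q q0).
    by rewrite lt_min !ge_min !lexx orbT; split=> //; lra.
  have Em : s - r * m = s' - r' * m by rewrite -fq ?fq0//; lra.
  have [-> ->] := line_unique tm Et Em.
  by apply: fq; lra.
exists (sup E); split => //.
  have [|p [pb fp]] := se_left hC (t := sup E); first lra.
  pose m := Num.max p t.
  have [|q Eq mq] := below m; first by rewrite gt_max; lra.
  have fm : affine_on C m (sup E).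
    by apply: affine_on_sub fp _ _; rewrite ?le_max ?lexx.
  by apply: affine_on_glue (Eq.2) fm _ mq (Eb _ Eq); rewrite le_max lexx orbT.
move=> d bd d1 fd; have : d <= sup E by apply: Eb; split=> //; lra.
by rewrite leNgt bd.
Qed.

Lemma affine_extent_left C t : steep_ends C -> 0 < t < 1 ->
  exists a, [/\ 0 < a, a < t, affine_on C a t &
    forall c, c < a -> 0 <= c -> ~ affine_on C c t].
Proof.
move=> hC t01.
have [|b [tb b1 fb maxb]] :=
    @affine_extent_right _ (1 - t) (steep_ends_refl hC).
  lra.
exists (1 - b); split; [lra|lra| |].
  have := affine_on_refl fb; rewrite subKr.
  by under [X in affine_on X]eq_fun do rewrite subKr.
move=> c cb c0 /affine_on_refl; apply: maxb; lra.
Qed.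

Lemma linearity_interval_ex C : steep_ends C ->
  exists I, linearity_intervals C I.
Proof.
move=> hC; pose t : R := 2^-1.
have [|b [tb b1 fb maxb]] := @affine_extent_right C t hC.
  by rewrite /t; lra.
have [|a [a0 ab fa maxa]] := @affine_extent_left C b hC.
  by move: tb; rewrite /t; lra.
have at_ : a <= t.
  by rewrite leNgt; apply/negP => ta; apply: maxa fb => //; rewrite /t; lra.
exists (a, b); split => //=; [lra|lra|move=> c d ca bd fcd].
have -> : c = a.
  apply/eqP; rewrite eq_le leNgt; apply/andP; split.
    by rewrite -leNgt; lra.
  rewrite leNgt; apply/negP => cac; apply: (maxa c) => //; first lra.
  by apply: affine_on_sub fcd _ _; lra.
have -> // : d = b.
apply/eqP; rewrite eq_le; apply/andP; split; last lra.
rewrite leNgt; apply/negP => bdd; apply: (maxb d) => //; first lra.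
by apply: affine_on_sub fcd _ _; lra.
Qed.

(** There is no accumulation of linearity intervals inside (0,1), so each one
    has an immediate successor. *)
Lemma linearity_interval_next C I : steep_ends C -> linearity_intervals C I ->
  exists2 J, linearity_intervals C J & J.1 = I.2.
Proof.
move=> hC iI; have [I0 I1] := linearity_interval_in hC iI.
have [_ I12 _ _ _] := iI.
have [|b [tb b1 fb maxb]] := @affine_extent_right C I.2 hC; first lra.
exists (I.2, b) => //; split => //=; [lra|lra|move=> c d ca bd fcd].
have -> : c = I.2.
  apply/eqP; rewrite eq_le; apply/andP; split; first lra.
  rewrite leNgt; apply/negP => cI.
  have fcb : affine_on C c b by apply: affine_on_sub fcd _ _; lra.
  have [||||] := linearity_interval_max iI fcb; lra.
have -> // : d = b.
apply/eqP; rewrite eq_le; apply/andP; split; last lra.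
rewrite leNgt; apply/negP => bdd; apply: (maxb d) => //; first lra.
by apply: affine_on_sub fcd _ _; lra.
Qed.

Definition right_chain C (I : nat -> R * R) :=
  (forall n, linearity_intervals C (I n)) /\ (forall n, (I n.+1).1 = (I n).2).

Lemma right_chain_mono C (I : nat -> R * R) n m : right_chain C I ->
  (n < m)%N -> (I n).1 < (I m).1.
Proof.
move=> [iI cI]; have S k : (I k).1 < (I k.+1).1 by rewrite cI; case: (iI k).
elim: m => // m IH; rewrite ltnS leq_eqVlt => /predU1P[->//|/IH].
by move/lt_trans; apply.
Qed.

Lemma right_chain_inj C (I : nat -> R * R) : right_chain C I -> injective I.
Proof.
move=> cI n m nm; case: (ltngtP n m) => // /(right_chain_mono cI).
  by rewrite nm ltxx.
by rewrite nm ltxx.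
Qed.

(** The limit of a chain cannot be inside (0,1): [C] is affine on some interval
    ending at that limit, which would cover two successive linearity intervals
    of the chain. *)
Lemma right_chain_cvg C (I : nat -> R * R) e : steep_ends C ->
  right_chain C I -> e < 1 -> exists n, e < (I n).1.
Proof.
move=> hC cI e1; have [iI sI] := cI; apply: contrapT => ne.
have ubI n : (I n).1 <= e.
  by rewrite leNgt; apply/negP => en; apply: ne; exists n.
pose E := [set (I n).1 | n in setT].
have supE : has_sup E by split; [exists (I 0%N).1, 0%N|exists e => _ [n _ <-]].
have Eb n : (I n).1 <= sup E by apply: ub_le_sup; [exact: supE.2|exists n].
have L1 : sup E <= e by apply: ge_sup; [exact: supE.1|move=> _ [n _ <-]].
have L0 : 0 < sup E.
  by apply: lt_le_trans (Eb 0%N); have [] := linearity_interval_in hC (iI 0%N).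
have [|p [pL fp]] := se_left hC (t := sup E); first lra.
have [_ [n _ <-] pn] := sup_gt supE.1 (proj2 (andP pL)).
have [_ n12 _ _ _] := iI n; have [_ + _ _ _] := iI n.+1.
have := Eb n.+2; rewrite !sI => bL nn.
have [] := linearity_interval_max (iI n) fp; lra.
Qed.

Lemma right_chain_ex C I : steep_ends C -> linearity_intervals C I ->
  exists2 J, right_chain C J & J 0%N = I.
Proof.
move=> hC iI.
have /choice[F HF] I' : exists J, linearity_intervals C I' ->
    linearity_intervals C J /\ J.1 = I'.2.
  have [iI'|nI'] := pselect (linearity_intervals C I').
    have [J iJ J1] := linearity_interval_next hC iI'.
    by exists J.
  by exists I'.
exists (fun n => iter n F I) => //.
have iF n : linearity_intervals C (iter n F I).
  by elim: n => //= n IH; case: (HF _ IH).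
by split=> // n; case: (HF _ (iF n)).
Qed.

(** Fix a point [u] at which [C] exceeds M (1 - u). Along the chain [C] tends to
    0, so the chords from [u] to the successive breakpoints eventually have
    slope below [- M]; by concavity the slopes [- r n] lie below those of the
    chords. *)
Lemma right_chain_slopes C (I : nat -> R * R) (s r : nat -> R) :
  steep_ends C -> right_chain C I ->
  (forall n t, (I n).1 <= t <= (I n).2 -> C t = s n - r n * t) ->
  r @ \oo --> +oo.
Proof.
move=> hC cI CE; apply/cvgryPge => A.
pose M := Num.max A 0.
have MA : A <= M by rewrite le_max lexx.
have M0 : 0 <= M by rewrite le_max lexx orbT.
have [u u01 Hu] := se_steep1 hC M.
pose e := (C u - M * (1 - u)) / 2.
have e0 : 0 < e by rewrite /e; lra.
have [K K0 HK] := se_small1 hC e0.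
have [|N HN] := @right_chain_cvg _ _ (Num.max u (1 - e / K)) hC cI.
  by rewrite gt_max; apply/andP; split; [lra|rewrite gtrBl divr_gt0].
exists N => // n /= Nn; apply: le_trans MA _.
have : Num.max u (1 - e / K) < (I n).1.
  apply: lt_le_trans HN _; move: Nn; rewrite leq_eqVlt => /predU1P[->//|].
  by move=> /(right_chain_mono cI)/ltW.
have [I0 I12 I1 _ _] := cI.1 n.
have := CE n (I n).1; have := CE n (I n).2; move: I0 I12 I1.
move: (I n).1 (I n).2 => x y x0 xy y1 /(_ _) Ey /(_ _) Ex.
have {}Ex : C x = s n - r n * x by apply: Ex; lra.
have {}Ey : C y = s n - r n * y by apply: Ey; lra.
rewrite gt_max => /andP[ux ex].
have H : (y - x) * C u + (x - u) * C y <= (y - u) * C x.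
  by apply: (se_concave hC); lra.
have Cx : C x <= e + K * (1 - x) by apply: HK; lra.
have Kx : K * (1 - x) <= e by rewrite mulrC -ler_pdivlMr//; lra.
have Mx : M * (x - u) <= M * (1 - u) by rewrite ler_wpM2l//; lra.
have xu : 0 < x - u by lra.
have yx : 0 < y - x by lra.
have D : M * (x - u) <= C u - C x by rewrite /e in Cx Kx; lra.
rewrite -(ler_pM2r xu); apply: le_trans D _.
rewrite -(ler_pM2l yx); rewrite Ey in H; rewrite Ex in H *; lra.
Qed.

End SteepEnds.

(** * Numbering the linearity intervals *)

Section Numbering.
Context {R : realType}.
Implicit Types (C : R -> R) (I J : nat -> R * R).

Definition left_chain C I :=
  (forall n, linearity_intervals C (I n)) /\ (forall n, (I n.+1).2 = (I n).1).

Lemma left_chain_refl C J : left_chain C J ->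
  right_chain (fun t => C (1 - t)) (fun n => (1 - (J n).2, 1 - (J n).1)).
Proof.
by move=> [iJ sJ]; split=> n /=; [exact: linearity_interval_refl|rewrite sJ].
Qed.

Lemma left_chain_ex C (I0 : R * R) : steep_ends C -> linearity_intervals C I0 ->
  exists2 J, left_chain C J & J 0%N = I0.
Proof.
move=> hC iI; have [J [iJ sJ] J0] :=
  right_chain_ex (steep_ends_refl hC) (linearity_interval_refl iI).
exists (fun n => (1 - (J n).2, 1 - (J n).1)).
  split=> n /=; last by rewrite sJ.
  have := linearity_interval_refl (iJ n).
  by under [X in linearity_intervals X]eq_fun do rewrite subKr.
by rewrite J0 /= !subKr -surjective_pairing.
Qed.

Lemma left_chain_inj C J : left_chain C J -> injective J.
Proof.
move=> /left_chain_refl/right_chain_inj iJ n m nm; apply: iJ; by rewrite /= nm.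
Qed.

Lemma left_chain_cvg C J e : steep_ends C -> left_chain C J -> 0 < e ->
  exists n, (J n).2 < e.
Proof.
move=> hC /left_chain_refl cJ e0.
have [|n /= Hn] := right_chain_cvg (e := 1 - e) (steep_ends_refl hC) cJ.
  lra.
by exists n; lra.
Qed.

Lemma left_chain_mono C J n m : left_chain C J -> (n <= m)%N ->
  (J m).2 <= (J n).2.
Proof.
move=> cJ; rewrite leq_eqVlt => /predU1P[->//|nm].
have := right_chain_mono (left_chain_refl cJ) nm => /=; lra.
Qed.

Lemma left_chain_slopes C J (s r : nat -> R) : steep_ends C -> left_chain C J ->
  (forall n t, (J n).1 <= t <= (J n).2 -> C t = s n - r n * t) ->
  r @ \oo --> -oo.
Proof.
move=> hC cJ CE; apply/cvgNry.
apply: (right_chain_slopes (s := fun n => s n - r n) (steep_ends_refl hC)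
  (left_chain_refl cJ)) => n t /= tI.
rewrite (CE n); first by rewrite ?opprfctE; ring.
lra.
Qed.

Lemma infinite_set_seq (T : Type) (f : nat -> T) (A : set T) :
  injective f -> (forall n, A (f n)) -> infinite_set A.
Proof.
move=> fi Af /(@sub_finite_set _ (range f)) H; apply: infinite_nat.
by rewrite -(eq_finite_set (inj_card_eq (in2W fi))); apply: H => _ [n _ <-].
Qed.

Lemma infinite_linearity_intervals_near1 C : steep_ends C ->
  forall A : set R, nbhs (1 : R) A ->
  infinite_set [set I | linearity_intervals C I /\
                        [set t | I.1 <= t <= I.2] `<=` A].
Proof.
move=> hC A /nbhs_ballP[e /= e0 eA].
have [I0 iI0] := linearity_interval_ex hC.
have [I cI _] := right_chain_ex hC iI0.
have [|N HN] := right_chain_cvg (e := 1 - e) hC cI; first lra.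
apply: (@infinite_set_seq _ (fun n => I (N + n)%N)) => [n m|n].
  by move=> /(right_chain_inj cI)/eqP; rewrite eqn_add2l => /eqP.
split; first exact: cI.1.
have [I1 I12 I2 _ _] := cI.1 (N + n)%N.
have IN : 1 - e < (I (N + n)%N).1.
  case: n {I1 I12 I2} => [|n]; first by rewrite addn0.
  apply: lt_trans HN _; apply: (right_chain_mono cI).
  by rewrite addnS ltnS leq_addr.
move=> t /= tI; apply: eA; rewrite /ball/= ltr_distlC; lra.
Qed.

Lemma infinite_linearity_intervals_near0 C : steep_ends C ->
  forall A : set R, nbhs (0 : R) A ->
  infinite_set [set I | linearity_intervals C I /\
                        [set t | I.1 <= t <= I.2] `<=` A].
Proof.
move=> hC A /nbhs_ballP[e /= e0 eA].
have [I0 iI0] := linearity_interval_ex hC.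
have [I cI _] := left_chain_ex hC iI0.
have [N HN] := left_chain_cvg hC cI e0.
apply: (@infinite_set_seq _ (fun n => I (N + n)%N)) => [n m|n].
  by move=> /(left_chain_inj cI)/eqP; rewrite eqn_add2l => /eqP.
split; first exact: cI.1.
have [I1 I12 I2 _ _] := cI.1 (N + n)%N.
have IN := left_chain_mono cI (leq_addr n N).
move=> t /= tI; apply: eA; rewrite /ball/= ltr_distlC; lra.
Qed.

(** One starts with any linearity interval and follows the chains of its
    successors and of its predecessors. They exhaust (0,1), and a linearity
    interval is determined by any of the points of its interior. *)
Lemma numbering_ex C : steep_ends C -> exists x s r, numbering C x s r.
Proof.
move=> hC; have [I0 iI0] := linearity_interval_ex hC.
have [I cI I0E] := right_chain_ex hC iI0.
have [J cJ J0E] := left_chain_ex hC iI0.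
(* Both chains start at the same interval, which gets the number 0; hence the
   shift, Negz n being - n.+1. *)
pose G (k : int) := match k with Posz n => I n | Negz n => J n.+1 end.
have iG k : linearity_intervals C (G k).
  by case: k => n; [exact: cI.1|exact: cJ.1].
have sG k : (G (k + 1)).1 = (G k).2.
  case: k => [n|[|n]].
  - by rewrite -PoszD addn1 /= cI.2.
  - by rewrite (_ : Negz 0 + 1 = 0)//= cJ.2 I0E J0E.
  - rewrite (_ : Negz n.+1 + 1 = Negz n) /=; first by rewrite cJ.2.
    by rewrite !NegzE; lia.
have GE k : ((G k).1, (G (k + 1)).1) = G k by rewrite sG -surjective_pairing.
have /choice[sr HSR] k : exists sr : R * R,
    forall t, (G k).1 <= t <= (G (k + 1)).1 -> C t = sr.1 - sr.2 * t.
  by have [_ _ _ [s [r Csr]] _] := iG k; exists (s, r); rewrite sG.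
exists (fun k => (G k).1), (fun k => (sr k).1), (fun k => (sr k).2).
split=> [k| |]; [by rewrite sG; case: (iG k)| |exact: HSR].
apply/seteqP; split=> [K iK|_ [k _ <-]]; last by rewrite GE.
have [K0 K1] := linearity_interval_in hC iK; have [_ K12 _ _ _] := iK.
have [N HN] := right_chain_cvg hC cI (lt_trans K12 K1).
have [m Hm] := left_chain_cvg hC cJ K0.
have Gm : (G (Negz m)).1 <= K.1.
  have := left_chain_mono cJ (leqnSn m).
  have [_ + _ _ _] := cJ.1 m.+1 => /=; lra.
have ex : exists n : nat, K.1 < (G (Negz m + n%:Z)).1.
  by exists (m.+1 + N)%N; rewrite (_ : Negz m + _ = N)// NegzE PoszD addKr.
(* The last interval of the chain starting at or before K.1 is K. *)
case: (ex_minnP ex) => -[|n]; first by rewrite addr0 ltNge Gm.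
rewrite -addn1 PoszD addrA => Kn minn; exists (Negz m + n%:Z) => //.
rewrite GE; apply: (linearity_interval_eq (iG _) iK); last by rewrite -sG.
apply: le_lt_trans K12; rewrite leNgt; apply/negP => /minn.
by rewrite addn1 ltnn.
Qed.

Lemma numbering_slopes C (x s r : int -> R) :
  steep_ends C -> numbering C x s r ->
  ((fun n : nat => r (- n%:Z)) @ \oo --> -oo) /\
  ((fun n : nat => r n%:Z) @ \oo --> +oo).
Proof.
move=> hC [xlt xE CE].
have ix k : linearity_intervals C (x k, x (k + 1)) by rewrite xE; exists k.
split.
  apply: (@left_chain_slopes C (fun n => (x (- n%:Z), x (- n%:Z + 1)))
    (fun n => s (- n%:Z))) => //; last by move=> n t; exact: CE.
  by split=> // n /=; congr x; lia.
apply: (@right_chain_slopes _ C (fun n => (x n%:Z, x (n%:Z + 1)))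
  (fun n => s n%:Z)) => //; last by move=> n t; exact: CE.
by split=> // n /=; congr x; lia.
Qed.

Lemma steep_ends_least_majorant (u v : nat -> R) : (forall k, 0 < u k < 1) ->
  (forall k, 0 < v k) -> (forall e, 0 < e -> finite_set [set k | e <= v k]) ->
  (forall M, exists k, M * u k < v k) ->
  (forall M, exists k, M * (1 - u k) < v k) ->
  steep_ends (least_concave_majorant u v).
Proof.
move=> u01 v0 vfin steep0 steep1.
have [cC C0 vC] := least_majorant_majorant u01 vfin.
split => //.
- by move=> t; exact: least_majorant_affine_right.
- by move=> t; exact: least_majorant_affine_left.
- by move=> e; exact: least_majorant_small0.
- by move=> e; exact: least_majorant_small1.
- move=> M; have [k Hk] := steep0 M.
  by exists (u k) => //; exact: lt_le_trans (vC k).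
- move=> M; have [k Hk] := steep1 M.
  by exists (u k) => //; exact: lt_le_trans (vC k).
Qed.

End Numbering.

(** * Integrals of powers *)

Section PowerIntegrals.
Context {R : realType}.
Local Notation mu := (@lebesgue_measure R).
Implicit Types (a b p M : R).

Lemma integral_is_derive (f F : R -> R) a b : a < b ->
  (forall x, a <= x <= b -> is_derive x 1 F (f x)) ->
  {within `[a, b], continuous f} ->
  (\int[mu]_(x in `[a, b]) (f x)%:E)%E = (F b - F a)%:E.
Proof.
move=> ab dF cf.
have cF x : a <= x <= b -> {for x, continuous F}.
  move=> /dF ?; exact/differentiable_continuous/derivable1_diffP.
rewrite (@continuous_FTC2 _ f F)//.
  split=> [x|  |].
  - rewrite in_itv/= => /andP[ax xb].
    by have := dF x; rewrite !ltW// => /(_ isT) ?.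
  - by apply: cvg_at_right_filter; apply: cF; rewrite lexx ltW.
  - by apply: cvg_at_left_filter; apply: cF; rewrite lexx ltW.
move=> x; rewrite in_itv/= => /andP[ax xb].
by have := dF x; rewrite !ltW// => /(_ isT) ?; rewrite derive1E derive_val.
Qed.

Lemma continuous_powR_itv a b p : 0 < a ->
  {within `[a, b], continuous (fun x => x `^ p : R)}.
Proof.
move=> a0; apply: derivable_within_continuous => x.
rewrite in_itv/= => /andP[ax _].
by have := is_derive1_powR p (lt_le_trans a0 ax) => ?.
Qed.

Lemma integral_powR a b p : 0 < a -> a < b -> p + 1 != 0 ->
  (\int[mu]_(x in `[a, b]) (x `^ p)%:E)%E =
  ((b `^ (p + 1) - a `^ (p + 1)) / (p + 1))%:E.
Proof.
move=> a0 ab p1.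
have dF x : a <= x <= b ->
    is_derive x 1 ((p + 1)^-1 \*: (fun x : R^o => x `^ (p + 1) : R^o)) (x `^ p).
  move=> /andP[ax _].
  have := is_derive1_powR (p + 1) (lt_le_trans a0 ax) => ?.
  apply: is_derive_eq; rewrite addrK.
  by rewrite /GRing.scale/= mulrA mulVf// mul1r.
rewrite (integral_is_derive ab dF (continuous_powR_itv a0)).
by rewrite /GRing.scale/= -mulrBr mulrC.
Qed.

Lemma measurable_powR_EFin p (D : set R) :
  measurable_fun D (fun x : R => (x `^ p)%:E).
Proof.
by apply/measurable_EFinP; apply: measurable_funTS; exact: measurable_powR.
Qed.

Lemma ge0_integral_bigcup_le (F : nat -> set R) (f : R -> \bar R) (M : \bar R) :
  (forall n m, (n <= m)%N -> F n `<=` F m) -> (forall n, measurable (F n)) ->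
  measurable_fun setT f -> (forall x, 0 <= f x)%E ->
  (forall n, \int[mu]_(x in F n) f x <= M)%E ->
  (\int[mu]_(x in \bigcup_n F n) f x <= M)%E.
Proof.
move=> ndF mF mf f0 FM.
have H := @ge0_nondecreasing_set_cvg_integral _ (measurableTypeR R) R F f mu.
have {}H : (\int[mu]_(x in F i) f x @[i --> \oo] -->
    \int[mu]_(x in \bigcup_i F i) f x)%E.
  apply: H => // [n m nm|n]; first by rewrite subsetEset; exact: ndF.
  exact: measurable_funTS.
rewrite -(cvg_lim _ H)//; apply: lime_le; last exact: nearW.
by apply/cvg_ex; eexists; exact: H.
Qed.

(** Uniformly in b, the integral over [a, b] is at most the opposite of the
    value of the primitive at [a]. *)
Lemma integral_powR_tail_lty a p : 0 < a -> p < - 1 ->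
  (\int[mu]_(x in `[a, +oo[) (x `^ p)%:E < +oo)%E.
Proof.
move=> a0 p1.
have -> : `[a, +oo[%classic = \bigcup_n `[a, a + n.+1%:R]%classic.
  apply/seteqP; split=> [x|x [n _]] /=; rewrite !in_itv/= ?andbT; last first.
    by case/andP.
  move=> ax; exists (Num.bound (x - a)) => //=; rewrite in_itv/= ax/=.
  have := archi_boundP (_ : 0 <= x - a); rewrite subr_ge0 => /(_ ax).
  by rewrite -natr1; lra.
apply: (@le_lt_trans _ _ (- (a `^ (p + 1) / (p + 1)))%:E); last exact: ltry.
apply: ge0_integral_bigcup_le.
- move=> n m nm x /=; rewrite !in_itv/= => /andP[-> /le_trans]; apply.
  by rewrite lerD2l ler_nat.
- by move=> n; exact: measurable_itv.
- exact: measurable_powR_EFin.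
- by move=> x; rewrite lee_fin powR_ge0.
- move=> n; rewrite integral_powR//; last 2 first.
  + by rewrite ltrDl.
  + by rewrite lt_eqF//; lra.
  rewrite lee_fin mulrBl.
  have := powR_ge0 (a + n.+1%:R) (p + 1).
  have : (p + 1)^-1 <= 0 by rewrite invr_le0; lra.
  by move=> h1 h2; have := mulr_ge0_le0 h2 h1; lra.
Qed.

Lemma bigcup_itv01 :
  `]0, 1]%classic = \bigcup_n `[n.+2%:R^-1, 1]%classic :> set R.
Proof.
apply/seteqP; split=> [x|x [n _]] /=; rewrite !in_itv/=; last first.
  by move=> /andP[nx ->]; rewrite andbT (lt_le_trans _ nx)// invr_gt0.
move=> /andP[x0 x1]; exists (Num.bound x^-1) => //=; rewrite in_itv/= x1 andbT.
apply: le_trans (inv_bound_le x0).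
by rewrite lef_pV2 ?posrE// ler_nat.
Qed.

Lemma inv_lt1 n : n.+2%:R^-1 < 1 :> R.
Proof. by rewrite invf_lt1// ltr1n. Qed.

Lemma integral_powR_01_lty p : - 1 < p ->
  (\int[mu]_(x in `]0%R, 1%R]) (x `^ p)%:E < +oo)%E.
Proof.
move=> p1; rewrite bigcup_itv01.
apply: le_lt_trans (_ : ((p + 1)^-1)%:E < +oo)%E; last exact: ltry.
apply: ge0_integral_bigcup_le.
- move=> n m nm x /=; rewrite !in_itv/= => /andP[nx ->]; rewrite andbT.
  by apply: le_trans nx; rewrite lef_pV2 ?posrE// ler_nat.
- by move=> n; exact: measurable_itv.
- exact: measurable_powR_EFin.
- by move=> x; rewrite lee_fin powR_ge0.
- move=> n; rewrite integral_powR ?inv_lt1 ?invr_gt0//; last first.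
    by rewrite gt_eqF//; lra.
  rewrite lee_fin powR1 mulrBl div1r gerBl divr_ge0 ?powR_ge0//; lra.
Qed.

(** Comparison with 1/x, whose integral over [exp(-A), 1] is [A]. *)
Lemma integral_powR_01_y p : p <= - 1 ->
  (\int[mu]_(x in `]0%R, 1%R]) (x `^ p)%:E = +oo)%E.
Proof.
move=> p1; apply/eqyP => A A0.
apply: (@le_trans _ _ (\int[mu]_(x in `[expR (- A), 1%R]) (x `^ p)%:E)%E);
    last first.
  apply: ge0_subset_integral => //; [exact: measurable_powR_EFin| |].
    by move=> x _; rewrite lee_fin powR_ge0.
  move=> x /=; rewrite !in_itv/= => /andP[Ax ->]; rewrite andbT.
  by apply: lt_le_trans Ax; exact: expR_gt0.
have eA0 := expR_gt0 (- A); have eA1 : expR (- A) < 1 by rewrite expR_lt1; lra.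
have cV : {within `[expR (- A), 1], continuous (@GRing.inv R)}.
  apply: derivable_within_continuous => x; rewrite in_itv/= => /andP[Ax _].
  by apply: derivableV => //; rewrite gt_eqF// (lt_le_trans _ Ax).
apply: (@le_trans _ _ (\int[mu]_(x in `[expR (- A), 1%R]) (x^-1)%:E)%E).
  have dln x : expR (- A) <= x <= 1 -> is_derive x 1 (@ln R) x^-1.
    by move=> /andP[Ax _]; apply: is_derive1_ln; apply: lt_le_trans Ax.
  by rewrite (integral_is_derive eA1 dln cV) ln1 expRK sub0r opprK.
apply: ge0_le_integral => //.
- move=> x /=; rewrite in_itv/= => /andP[Ax _].
  by rewrite lee_fin invr_ge0 ltW// (lt_le_trans _ Ax).
- by apply/measurable_EFinP; exact: subspace_continuous_measurable_fun.
- exact: measurable_powR_EFin.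
- move=> x /=; rewrite in_itv/= => /andP[Ax x1].
  have x0 : 0 < x by apply: lt_le_trans Ax.
  rewrite lee_fin -(@powR_inv1 _ x) ?(ltW x0)//.
  by apply: ger_powR; rewrite ?x0.
Qed.

End PowerIntegrals.

(** * The intensity of half-planes and wedges *)

Section Intensity.
Context {R : realType}.
Variable alpha : R.
Hypothesis alpha_gt0 : 0 < alpha.
Local Notation mu := (@lebesgue_measure R).
Local Notation plane := (measurableTypeR R * measurableTypeR R)%type.
Implicit Types (B : set plane) (E : set R) (g : R -> R).

Lemma stripE : @strip R = (`[0, 1]%classic `*` `]0, +oo[%classic : set plane).
Proof.
by apply/seteqP; split=> [[x y]|[x y]] /=; rewrite !in_itv/= andbT.
Qed.

Lemma measurable_strip : measurable (@strip R : set plane).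
Proof. by rewrite stripE; apply: measurableX; exact: measurable_itv. Qed.

Lemma measurable_strip_part B : measurable B -> measurable (B `&` @strip R).
Proof. by move=> mB; apply: measurableI => //; exact: measurable_strip. Qed.

Lemma density_ge0 (y : R) : (0 <= (alpha * y `^ (- (alpha + 1)))%:E)%E.
Proof. by rewrite lee_fin mulr_ge0 ?powR_ge0// ltW. Qed.

Lemma measurable_density (D : set (measurableTypeR R)) : measurable_fun D
  (fun y : measurableTypeR R => (alpha * y `^ (- (alpha + 1)))%:E).
Proof.
apply/measurable_EFinP; apply: measurable_funM => //.
by apply: measurable_funTS; exact: measurable_powR.
Qed.

(** Tonelli's theorem, with the height as the outer variable: the density
    depends only on the height, so only the lengths of the horizontal slices
    matter, and the two ends of [0,1] play symmetric roles. *)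
Lemma stable_intensityE B : measurable B -> stable_intensity alpha B =
  (\int[mu]_y ((alpha * y `^ (- (alpha + 1)))%:E *
     mu (ysection (B `&` @strip R) y)))%E.
Proof.
move=> mB; have mD := measurable_strip_part mB.
rewrite /stable_intensity integral_mkcond fubini_tonelli2//.
- apply: eq_integral => y _; rewrite /fubini_G.
  rewrite (_ : (fun x => _) =
    (fun x => (alpha * y `^ (- (alpha + 1)))%:E) \_
      (ysection (B `&` @strip R) y)); last first.
    apply/funext => x; rewrite /patch.
    by congr (if _ then _ else _); apply/idP/idP; rewrite !inE => /ysectionP.
  rewrite -integral_mkcond integral_cst//; exact: measurable_ysection.
- apply/(measurable_restrictT _ mD); apply: measurable_funTS.
  apply: (@measurableT_comp _ _ _ _ _ _
    (fun y : measurableTypeR R => (alpha * y `^ (- (alpha + 1)))%:E)) => //.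
  exact: measurable_density.
- by move=> z; apply: erestrict_ge0 => x _; exact: density_ge0.
Qed.

Lemma stable_intensity_le B E g : measurable B -> measurable E ->
  measurable_fun E g -> (forall y, E y -> 0 <= g y) ->
  (forall z, B z -> strip z -> E z.2) ->
  (forall y, E y -> mu (ysection (B `&` @strip R) y) <= (g y)%:E)%E ->
  (stable_intensity alpha B <=
    \int[mu]_(y in E) (alpha * y `^ (- (alpha + 1)) * g y)%:E)%E.
Proof.
move=> mB mE mg g0 BE Bg; rewrite stable_intensityE//.
have mD := measurable_strip_part mB.
rewrite [leRHS]integral_mkcond; apply: ge0_le_integral => //.
- by move=> y _; rewrite mule_ge0// density_ge0.
- apply: emeasurable_funM; first exact: measurable_density.
  exact: measurable_fun_ysection.
- apply/(measurable_restrictT _ mE); apply/measurable_EFinP.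
  apply: measurable_funM => //.
  by apply/measurable_EFinP; exact: measurable_density.
- move=> y _; rewrite /patch; case: ifPn => [/set_mem Ey|/negP Ey].
    rewrite (EFinM (alpha * _)).
    by apply: lee_wpmul2l; [exact: density_ge0|exact: Bg].
  rewrite (_ : ysection _ _ = set0) ?measure0 ?mule0//.
  apply/seteqP; split=> // x /ysectionP[Bx sx]; apply: Ey; apply/mem_set.
  exact: (BE (x, y)).
Qed.

Lemma stable_intensity_ge B E g : measurable B -> measurable E ->
  measurable_fun E g -> (forall y, E y -> 0 <= g y) ->
  (forall y, E y -> (g y)%:E <= mu (ysection (B `&` @strip R) y))%E ->
  (\int[mu]_(y in E) (alpha * y `^ (- (alpha + 1)) * g y)%:E <=
   stable_intensity alpha B)%E.
Proof.
move=> mB mE mg g0 Bg; rewrite stable_intensityE//.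
have mD := measurable_strip_part mB.
rewrite [leLHS]integral_mkcond; apply: ge0_le_integral => //.
- move=> y _; apply: erestrict_ge0 => x Ex.
  by rewrite lee_fin !mulr_ge0 ?powR_ge0 ?g0// ltW.
- apply/(measurable_restrictT _ mE); apply/measurable_EFinP.
  apply: measurable_funM => //.
  by apply/measurable_EFinP; exact: measurable_density.
- apply: emeasurable_funM; first exact: measurable_density.
  exact: measurable_fun_ysection.
- move=> y _; rewrite /patch; case: ifPn => [/set_mem Ey|/negP Ey].
    rewrite (EFinM (alpha * _)).
    by apply: lee_wpmul2l; [exact: density_ge0|exact: Bg].
  by rewrite mule_ge0// density_ge0.
Qed.

Lemma mu_itv_cc (a b : R) : a <= b -> mu `[a, b]%classic = (b - a)%:E.
Proof.
rewrite le_eqVlt => /predU1P[->|ab].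
  by rewrite set_itv1 lebesgue_measure_set1 subrr.
by rewrite lebesgue_measure_itv/= lte_fin ab.
Qed.

Lemma measurable_le_set (f g : plane -> R) : measurable_fun setT f ->
  measurable_fun setT g -> measurable [set z | f z <= g z].
Proof.
by move=> mf mg; rewrite -[X in measurable X]setTI; exact: measurable_fun_le.
Qed.

Lemma ysection_le_mu B (F : set R) y (r : R) : measurable B -> measurable F ->
  mu F = r%:E -> (forall x, B (x, y) -> 0 <= x <= 1 -> 0 < y -> F x) ->
  (mu (ysection (B `&` @strip R) y) <= r%:E)%E.
Proof.
move=> mB mF <- BF; apply: le_measure; rewrite ?inE//.
  by apply: measurable_ysection; exact: measurable_strip_part.
by move=> x /ysectionP[Bx [/= x01 y0]]; exact: BF.
Qed.

Lemma stable_intensity_high e : 0 < e ->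
  (stable_intensity alpha [set z : plane | (e <= z.2)%R] < +oo)%E.
Proof.
move=> e0; apply: le_lt_trans (_ : (alpha%:E *
    \int[mu]_(y in `[e, +oo[) (y `^ (- (alpha + 1)))%:E < +oo))%E; last first.
  rewrite lte_mul_pinfty ?lee_fin ?(ltW alpha_gt0)//.
  by apply: integral_powR_tail_lty => //; move: alpha_gt0; lra.
rewrite -ge0_integralZl ?lee_fin ?(ltW alpha_gt0)//; last 2 first.
- exact: measurable_powR_EFin.
- by move=> y _; rewrite lee_fin powR_ge0.
under eq_integral do rewrite -EFinM -[_ * _]mulr1.
have mB : measurable [set z : plane | (e <= z.2)%R] by exact: measurable_le_set.
apply: stable_intensity_le => //.
- by move=> z /=; rewrite in_itv/= andbT.
- move=> y _; apply: (@ysection_le_mu _ `[0, 1]%classic) => //.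
  by rewrite mu_itv_cc// subr0.
Qed.

Lemma stable_intensity_vertical (a : R) :
  stable_intensity alpha [set z : plane | z.1 = a] = 0%E.
Proof.
have -> : [set z : plane | z.1 = a] = [set a] `*` setT.
  by apply/seteqP; split=> [[x y]|[x y] []].
have mB : measurable ([set a] `*` setT : set plane) by exact: measurableX.
apply/eqP; rewrite eq_le; apply/andP; split; last first.
  by apply: integral_ge0 => z _; exact: density_ge0.
have := @stable_intensity_le _ setT (fun=> 0) mB.
under eq_integral do rewrite mulr0.
rewrite integral0; apply=> // y _.
apply: (@ysection_le_mu _ [set a]) => //; first exact: lebesgue_measure_set1.
by move=> x [].
Qed.

Definition edge_dist (b : bool) (x : R) := if b then 1 - x else x.

(** A line through an end of [0,1] bounds the region from below; the cut at
    height 1 isolates the behaviour near that end, the intensity of higher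
    points being finite in any case. *)
Definition wedge b (c : R) : set plane :=
  [set z | c * edge_dist b z.1 <= z.2] `&` [set z | z.2 <= 1].

Definition edge_itv (b : bool) (r : R) : set R :=
  if b then `[1 - r, 1]%classic else `[0, r]%classic.

Lemma edge_itvP b r x : edge_itv b r x <-> 0 <= edge_dist b x <= r.
Proof. by case: b; rewrite /edge_itv/= in_itv/=; split; lra. Qed.

Lemma mu_edge_itv b r : 0 <= r -> mu (edge_itv b r) = r%:E.
Proof.
move=> r0; case: b; rewrite /edge_itv mu_itv_cc ?subr0//; last lra.
by congr EFin; ring.
Qed.

Lemma measurable_edge_itv b r : measurable (edge_itv b r).
Proof. by case: b; exact: measurable_itv. Qed.

Lemma measurable_wedge b c : measurable (wedge b c).
Proof.
apply: measurableI; apply: measurable_le_set => //.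
apply: measurable_funM => //; rewrite /edge_dist; case: b.
  exact: measurable_funB.
exact: measurable_fst.
Qed.

Lemma integral_wedge c : 0 < c ->
  (\int[mu]_(y in `]0%R, 1%R]) (alpha * y `^ (- (alpha + 1)) * (y / c))%:E =
   (alpha / c)%:E * \int[mu]_(y in `]0%R, 1%R]) (y `^ (- alpha))%:E)%E.
Proof.
move=> c0.
rewrite -ge0_integralZl ?lee_fin ?divr_ge0 ?(ltW alpha_gt0) ?(ltW c0)//;
    last 2 first.
- exact: measurable_powR_EFin.
- by move=> y _; rewrite lee_fin powR_ge0.
apply: eq_integral => y; rewrite inE/= in_itv/= => /andP[y0 _].
rewrite -EFinM; congr EFin.
have -> : - alpha = - (alpha + 1) + 1 by ring.
rewrite powRD ?(gt_eqF y0) ?implybT// powRr1 ?ltW//.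
by field; rewrite gt_eqF.
Qed.

(** The slice of a wedge at height [y] has length at most [y / c], so its
    intensity is at most a multiple of the integral of [y `^ (- alpha)] near 0;
    for [1 <= c] this is an equality, whence the dichotomy at [alpha = 1]. *)
Lemma stable_intensity_wedge_lty b c : 0 < c -> alpha < 1 ->
  (stable_intensity alpha (wedge b c) < +oo)%E.
Proof.
move=> c0 a1; apply: (@le_lt_trans _ _ (\int[mu]_(y in `]0%R, 1%R])
    (alpha * y `^ (- (alpha + 1)) * (y / c))%:E)%E); last first.
  rewrite integral_wedge// lte_mul_pinfty ?lee_fin//.
    by rewrite divr_ge0// ltW.
  by apply: integral_powR_01_lty; lra.
apply: stable_intensity_le => //; first exact: measurable_wedge.
- exact: measurable_funM.
- by move=> y; rewrite /= in_itv/= => /andP[y0 _]; rewrite divr_ge0// ltW.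
- by move=> z [_ /= z1] [_ z0]; rewrite in_itv/= z0.
- move=> y; rewrite /= in_itv/= => /andP[y0 _].
  apply: (@ysection_le_mu _ (edge_itv b (y / c))).
  + exact: measurable_wedge.
  + exact: measurable_edge_itv.
  + by apply: mu_edge_itv; rewrite divr_ge0// ltW.
  + move=> x [/= cx _] x01 _; apply/edge_itvP.
    rewrite ler_pdivlMr// mulrC cx andbT; case: b {cx} => /=; lra.
Qed.

Lemma stable_intensity_wedge_y b c : 1 <= c -> 1 <= alpha ->
  stable_intensity alpha (wedge b c) = +oo%E.
Proof.
move=> c1 a1; have c0 : 0 < c by lra.
apply/eqP; rewrite -leye_eq.
apply: (@le_trans _ _ (\int[mu]_(y in `]0%R, 1%R])
    (alpha * y `^ (- (alpha + 1)) * (y / c))%:E)%E).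
  rewrite integral_wedge// integral_powR_01_y; last lra.
  by rewrite gt0_muley// lte_fin divr_gt0.
have mD := measurable_strip_part (measurable_wedge b c).
apply: stable_intensity_ge => //; first exact: measurable_wedge.
- exact: measurable_funM.
- by move=> y; rewrite /= in_itv/= => /andP[y0 _]; rewrite divr_ge0// ltW.
- move=> y; rewrite /= in_itv/= => /andP[y0 y1].
  rewrite -(mu_edge_itv b (r := y / c)); last by rewrite divr_ge0// ltW.
  apply: le_measure; rewrite ?inE; first exact: measurable_edge_itv.
    exact: measurable_ysection.
  move=> x /edge_itvP; rewrite ler_pdivlMr// mulrC => /andP[e0 ec].
  apply/ysectionP; split; split => //=.
  have : edge_dist b x <= 1.
    apply: (@le_trans _ _ (c * edge_dist b x)); first by rewrite ler_peMl.
    exact: le_trans y1.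
  by move: e0; case: b {ec mD} => /=; lra.
Qed.

End Intensity.

(** * Poisson laws and counting *)

Section PoissonEvents.
Context {R : realType} {d : measure_display} {Omega : measurableType d}.
Variable P : probability Omega R.

Lemma ae_of_prob1 (E : set Omega) : measurable E -> P E = 1%E ->
  {ae P, forall w, E w}.
Proof.
move=> mE PE; exists (~` E); split => //; first exact: measurableC.
by rewrite probability_setC// PE subee.
Qed.

Lemma measurable_level (N : Omega -> \bar R) x :
  measurable_fun setT N -> measurable [set w | N w = x].
Proof.
by move=> mN; rewrite -[X in measurable X]setTI;
  exact: (mN measurableT [set x]).
Qed.

(** A Poisson law with finite mean gives total mass 1 to the integers. *)
Lemma poisson_law_lty (N : Omega -> \bar R) m : measurable_fun setT N ->
  has_poisson_law P N m -> (m < +oo)%E -> {ae P, forall w, (N w < +oo)%E}.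
Proof.
move=> mN law moo; move: law; rewrite /has_poisson_law lt_eqF// => law.
pose E n := [set w | N w = n%:R%:E].
have mE n : measurable (E n) by exact: measurable_level.
have PE : P (\bigcup_n E n) = 1%E.
  rewrite measure_bigcup//; last first.
    apply/trivIsetP => i j _ _ ij; apply/seteqP; split=> // w [Ei Ej].
    by move: Ei; rewrite /E/= Ej => -[] /eqP;
      rewrite eqr_nat eq_sym (negbTE ij).
  rewrite -(@probability_setT _ _ _ (poisson_prob (fine m) 0%N)).
  have TE : [set: nat] = \bigcup_n [set n].
    by apply/seteqP; split=> // n _; exists n.
  rewrite [in RHS]TE.
  rewrite measure_bigcup//; last first.
    apply/trivIsetP => i j _ _ ij; apply/seteqP; split=> // n [] -> /eqP.
    by rewrite (negbTE ij).
  by apply: eq_eseriesr => n _; exact: law.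
have mUE := bigcup_measurable (fun n (_ : setT n) => mE n).
by apply: filterS (ae_of_prob1 mUE PE) => w [n _ ->]; exact: ltry.
Qed.

Lemma poisson_law_y (N : Omega -> \bar R) : measurable_fun setT N ->
  has_poisson_law P N +oo%E -> {ae P, forall w, N w = +oo%E}.
Proof.
move=> mN; rewrite /has_poisson_law eqxx => /ae_of_prob1; apply.
exact: measurable_level.
Qed.

Lemma poisson_law_0 (N : Omega -> \bar R) : measurable_fun setT N ->
  has_poisson_law P N 0%E -> {ae P, forall w, N w = 0%E}.
Proof.
move=> mN; rewrite /has_poisson_law /= => /(_ 0%N) law.
apply: (ae_of_prob1 (measurable_level _ mN)); rewrite [LHS]law.
by rewrite /poisson_prob/= ltxx diracE mem_set.
Qed.

End PoissonEvents.

Lemma counting_lty (R : realType) (A : set nat) :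
  (@counting _ R A < +oo)%E -> finite_set A.
Proof. by rewrite /counting; case: asboolP. Qed.

Lemma counting_y (R : realType) (A : set nat) :
  @counting _ R A = +oo%E -> A !=set0.
Proof.
rewrite /counting; case: asboolP => // iA _; apply/set0P/eqP => A0.
by apply: iA; rewrite A0.
Qed.

Lemma counting_0 (R : realType) (A : set nat) :
  @counting _ R A = 0%E -> forall k, ~ A k.
Proof.
rewrite /counting; case: asboolP => // -[n An] [] /eqP.
rewrite (card_fset_set An) pnatr_eq0 => /eqP n0 k Ak; move: An.
by rewrite n0 II0 card_eq0 => /eqP A0; rewrite A0 in Ak.
Qed.

(** * Almost sure properties of the point process *)

Section PointProcess.
Context {R : realType} {d : measure_display} {Omega : measurableType d}.
Local Notation plane := (measurableTypeR R * measurableTypeR R)%type.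
Variables (P : probability Omega R) (alpha : R) (rho : R.-ker Omega ~> plane).
Variables (U V : nat -> Omega -> R).
Hypothesis alpha_gt0 : 0 < alpha.
Hypothesis rho_ppp : poisson_point_process P (stable_intensity alpha) rho.
Hypothesis UV_strip : {ae P, forall w, forall k, strip (U k w, V k w)}.
Hypothesis rhoE : {ae P, forall w, forall B : set plane,
  measurable B -> rho w B = (\sum_(0 <= k <oo) \d_(U k w, V k w) B)%E}.

(** Almost surely [rho w B] counts the indices of the points that lie in [B]. *)
Lemma ae_counting (Q : \bar R -> Prop) (B : set plane) : measurable B ->
  {ae P, forall w, Q (rho w B)} ->
  {ae P, forall w, Q (counting [set k | B (U k w, V k w)])}.
Proof.
move=> mB; apply: filterS2 rhoE => w /(_ B mB) -> ; rewrite counting_dirac.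
by under eq_eseriesr do rewrite diracE -[in X in (X%:R)]/(_ \in _).
Qed.

Lemma ae_finite (B : set plane) : measurable B ->
  (stable_intensity alpha B < +oo)%E ->
  {ae P, forall w, finite_set [set k | B (U k w, V k w)]}.
Proof.
move=> mB /(poisson_law_lty (measurable_kernel rho B mB) (rho_ppp.1 B mB)).
by move/(ae_counting (Q := fun x => (x < +oo)%E) mB); apply: filterS => w;
  exact: counting_lty.
Qed.

Lemma ae_nonempty (B : set plane) : measurable B ->
  stable_intensity alpha B = +oo%E ->
  {ae P, forall w, exists k, B (U k w, V k w)}.
Proof.
move=> mB By; have := rho_ppp.1 B mB; rewrite By.
move/(poisson_law_y (measurable_kernel rho B mB)).
by move/(ae_counting (Q := fun x => x = +oo%E) mB);
  apply: filterS => w /counting_y.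
Qed.

Lemma ae_empty (B : set plane) : measurable B ->
  stable_intensity alpha B = 0%E ->
  {ae P, forall w, forall k, ~ B (U k w, V k w)}.
Proof.
move=> mB By; have := rho_ppp.1 B mB; rewrite By.
move/(poisson_law_0 (measurable_kernel rho B mB)).
by move/(ae_counting (Q := fun x => x = 0%E) mB);
  apply: filterS => w /counting_0.
Qed.

Lemma ae_interior : {ae P, forall w, forall k, 0 < U k w < 1}.
Proof.
have mV (a : R) : measurable [set z : plane | z.1 = a].
  have -> : [set z : plane | z.1 = a] = [set a] `*` setT.
    by apply/seteqP; split=> [[x y]|[x y] []].
  exact: measurableX.
have := ae_empty (mV 0) (stable_intensity_vertical alpha_gt0 0).
have := ae_empty (mV 1) (stable_intensity_vertical alpha_gt0 1).
apply: filterS3 UV_strip => w sUV n1 n0 k.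
have [/= /andP[u0 u1] _] := sUV k.
rewrite !lt_neqAle u0 u1 !andbT eq_sym; apply/andP; split; apply/eqP.
  exact: n0.
exact: n1.
Qed.

Lemma ae_locally_finite : {ae P, forall w, forall e, 0 < e ->
  finite_set [set k | e <= V k w]}.
Proof.
have mB (e : R) : measurable [set z : plane | e <= z.2].
  exact: measurable_le_set.
have : {ae P, forall w, forall n, finite_set [set k | n.+1%:R^-1 <= V k w]}.
  apply: ae_foralln => n; apply: (ae_finite (mB _)).
  by apply: stable_intensity_high.
apply: filterS => w fin e e0.
apply: sub_finite_set (fin (Num.bound e^-1)) => k /=; apply: le_trans.
exact: inv_bound_le.
Qed.

(** A point above the line of slope [c] is either high or in one of the two
    wedges; for [alpha < 1] each of these three regions has finite intensity. A
    sequence of slopes tending to 0 suffices. *)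
Lemma ae_wedges_finite : alpha < 1 -> {ae P, forall w, forall c, 0 < c ->
  finite_set [set k | c * Num.min (U k w) (1 - U k w) <= V k w]}.
Proof.
move=> a1.
have fb b : {ae P, forall w, forall n, finite_set
    [set k | wedge b n.+1%:R^-1 (U k w, V k w)]}.
  apply: ae_foralln => n; apply: ae_finite; first exact: measurable_wedge.
  exact: stable_intensity_wedge_lty.
apply: filterS3 (filterI ae_interior ae_locally_finite) (fb true) (fb false).
move=> w [u01 fin] ft ff c c0.
pose n := Num.bound c^-1.
have nc : n.+1%:R^-1 <= c by exact: inv_bound_le.
apply: (@sub_finite_set _ _ ([set k | 1 <= V k w] `|`
  ([set k | wedge true n.+1%:R^-1 (U k w, V k w)] `|`
   [set k | wedge false n.+1%:R^-1 (U k w, V k w)]))); last first.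
  by rewrite !finite_setU; split; [exact: fin|split].
move=> k /= cV; case: (leP 1 (V k w)) => V1; first by left.
have V1' := ltW V1; right; move: cV; rewrite /Num.min; case: ifPn => _ cV.
  right; split=> //=; apply: le_trans cV; rewrite ler_wpM2r//.
  by have := u01 k; lra.
left; split=> //=; apply: le_trans cV; rewrite ler_wpM2r//.
by have := u01 k; lra.
Qed.

Lemma ae_steep b : 1 <= alpha -> {ae P, forall w, forall M, exists k,
  M * edge_dist b (U k w) < V k w}.
Proof.
move=> a1.
have fb : {ae P, forall w, forall n, exists k, wedge b n.+1%:R (U k w, V k w)}.
  apply: ae_foralln => n; apply: ae_nonempty; first exact: measurable_wedge.
  by apply: stable_intensity_wedge_y => //; rewrite ler1n.
apply: filterS2 ae_interior fb => w u01 H M.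
have [k [/= kn _]] := H (Num.bound `|M|); exists k; apply: lt_le_trans kn.
have e0 : 0 < edge_dist b (U k w) by have := u01 k; case: b {H} => /=; lra.
rewrite ltr_pM2r//; apply: le_lt_trans (ler_norm M) _.
by apply: lt_le_trans (archi_boundP _) _ => //; rewrite ler_nat.
Qed.

End PointProcess.

(** * Linearity intervals of the majorant of a stable Poisson process *)

Theorem proposition1p7 (R : realType) (d : measure_display)
    (Omega : measurableType d) (P : probability Omega R) (alpha : R)
    (rho : R.-ker Omega ~> (measurableTypeR R * measurableTypeR R)%type)
    (U V : nat -> Omega -> R)
    (alpha_gt0 : 0 < alpha)
    (rho_ppp : poisson_point_process P (stable_intensity alpha) rho)
    (UV_strip : {ae P, forall w, forall k, strip (U k w, V k w)})
    (rhoE : {ae P, forall w, forall B : set (measurableTypeR R * measurableTypeR R),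
       measurable B -> rho w B = (\sum_(0 <= k <oo) \d_(U k w, V k w) B)%E}) :
  let C (w : Omega) : R -> R :=
    least_concave_majorant (fun k => U k w) (fun k => V k w) in
  (alpha < 1 ->
     {ae P, forall w, (number_of_linearity_intervals (C w) < +oo)%E}) /\
  (1 <= alpha ->
     [/\ {ae P, forall w, number_of_linearity_intervals (C w) = +oo%E},
         {ae P, forall w, forall A : set R, nbhs (0 : R) A ->
            infinite_set [set I | linearity_intervals (C w) I /\
                                  [set t | I.1 <= t <= I.2] `<=` A]},
         {ae P, forall w, forall A : set R, nbhs (1 : R) A ->
            infinite_set [set I | linearity_intervals (C w) I /\
                                  [set t | I.1 <= t <= I.2] `<=` A]} &
         {ae P, forall w,
            (exists x s r : int -> R, numbering (C w) x s r) /\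
            (forall x s r : int -> R, numbering (C w) x s r ->
               ((fun n : nat => r (- n%:Z)) @ \oo --> -oo) /\
               ((fun n : nat => r n%:Z) @ \oo --> +oo))}]).
Proof.
move=> C.
have u01 := ae_interior alpha_gt0 rho_ppp UV_strip rhoE.
have vfin := ae_locally_finite alpha_gt0 rho_ppp rhoE.
have v0 : {ae P, forall w, forall k, 0 < V k w}.
  by apply: filterS UV_strip => w sUV k; case: (sUV k).
have uv : {ae P, forall w, [/\ forall k, 0 < U k w < 1, forall k, 0 < V k w &
    forall e, 0 < e -> finite_set [set k | e <= V k w]]}.
  by apply: filterS3 u01 v0 vfin => w.
split=> a1.
  have fw := ae_wedges_finite alpha_gt0 rho_ppp UV_strip rhoE a1.
  apply: filterS2 uv fw => w [hu hv hfin] hw.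
  have := least_majorant_finite_intervals hu hv hfin hw.
  by rewrite /number_of_linearity_intervals /counting => /asboolT ->;
    exact: ltry.
have hC : {ae P, forall w, steep_ends (C w)}.
  have s0 := ae_steep alpha_gt0 rho_ppp UV_strip rhoE false a1.
  have s1 := ae_steep alpha_gt0 rho_ppp UV_strip rhoE true a1.
  by apply: filterS3 uv s0 s1 => w [hu hv hfin] h0 h1;
    exact: steep_ends_least_majorant.
split; apply: filterS hC => w hC.
- have := infinite_linearity_intervals_near1 hC (A := setT) filterT.
  rewrite /number_of_linearity_intervals /counting => iA.
  case: asboolP => // fC; exfalso; apply: iA.
  by apply: sub_finite_set fC => I [].
- exact: infinite_linearity_intervals_near0.
- exact: infinite_linearity_intervals_near1.
- by split; [exact: numbering_ex|move=> x s r; exact: numbering_slopes].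
Qed.
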